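(* For all $i\ne j$ in $\{1,\dots,K\}$, $$\left|\mathrm{Cov}_{\nu_N}\big(\eta(i)/N,\eta(j)/N\big)\right|\sim_N\frac{p+1}{K^2N},$$ i.e. for fixed $K$ and $p$ the ratio of the two sides tends to $1$ as $N\to+\infty$.
   Context: Fix an integer $K\ge1$ and $p>0$. For an integer $N\ge2$, let $E=\{\eta:\{1,\dots,K\}\to\mathbb{N}:\sum_{i=1}^K\eta(i)=N\}$, and let $T_{i\to j}\eta$ be obtained from $\eta$ by decreasing $\eta(i)$ by 1 and increasing $\eta(j)$ by 1 (when $\eta(i)\ne0$; $T_{i\to i}\eta=\eta$). The Fleming-Viot process of the complete graph random walk is the Markov process on $E$ with generator $$\mathcal{L}f(\eta)=\sum_{i=1}^K\eta(i)\sum_{j=1}^K\big(f(T_{i\to j}\eta)-f(\eta)\big)\Big(\frac1K+p\frac{\eta(j)}{N-1}\Big).$$ It is irreducible on a finite state space; $\nu_N$ is its unique invariant distribution. $\mathrm{Cov}_{\nu_N}$ denotes covariance when $\eta$ has law $\nu_N$. *)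

(* Defs.v *)
From HB Require Import structures.
From mathcomp Require Import all_boot all_order all_algebra.
From mathcomp Require Import all_classical all_reals all_analysis.

Set Implicit Arguments.
Unset Strict Implicit.
Unset Printing Implicit Defensive.

Import Order.TTheory GRing.Theory Num.Theory.
Import numFieldNormedType.Exports.

Local Open Scope classical_set_scope.
Local Open Scope ring_scope.

Record config (K N : nat) := Config {
  occ :> {ffun 'I_K -> nat};
  _ : (\sum_(i < K) occ i == N)%N
}.

HB.instance Definition _ (K N : nat) := [isSub for @occ K N].
HB.instance Definition _ (K N : nat) := [Countable of config K N by <:].

Lemma config_sum (K N : nat) (eta : config K N) : (\sum_(i < K) eta i = N)%N.
Proof. exact/eqP/(valP eta). Qed.

Lemma config_le (K N : nat) (eta : config K N) (i : 'I_K) : (eta i <= N)%N.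
Proof. by rewrite -{2}(config_sum eta) (bigD1 i) //= leq_addr. Qed.

Definition config_bounded (K N : nat) (eta : config K N) :
  {ffun 'I_K -> 'I_N.+1} := [ffun i => inord (eta i)].

Definition bounded_config (K N : nat) (b : {ffun 'I_K -> 'I_N.+1}) :
  option (config K N) := insub [ffun i => nat_of_ord (b i)].

Lemma config_boundedK (K N : nat) :
  pcancel (@config_bounded K N) (@bounded_config K N).
Proof.
move=> eta; rewrite /bounded_config.
have -> : [ffun i => nat_of_ord (config_bounded eta i)] = val eta.
  by apply/ffunP => i; rewrite !ffunE inordK // ltnS config_le.
exact: valK.
Qed.

HB.instance Definition _ (K N : nat) :=
  fintype.isFinite.Build (config K N) (pcan_enumP (@config_boundedK K N)).

(* Truncated subtraction is harmless when eta i > 0; the net effect is then   *)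
(* nil for i = j.                                                             *)
Definition jump_fun (K : nat) (i j : 'I_K) (eta : {ffun 'I_K -> nat}) :
  {ffun 'I_K -> nat} := [ffun k => (eta k - (k == i) + (k == j))%N].

(* T_{i -> j}, extended by the identity to configurations with eta i = 0,     *)
(* where jump_fun leaves the state space (see jumpE). In the generator such   *)
(* jumps carry the factor eta i = 0.                                          *)
Definition jump (K N : nat) (i j : 'I_K) (eta : config K N) : config K N :=
  insubd eta (jump_fun i j eta).

Lemma jumpE (K N : nat) (i j : 'I_K) (eta : config K N) :
  eta i != 0%N -> occ (jump i j eta) = jump_fun i j eta.
Proof.
move=> eta_i; apply: insubdK; rewrite unfold_in; apply/eqP.
have sum_eq k : (\sum_(l < K) (l == k) = 1)%N.
  by rewrite (bigD1 k) //= eqxx big1 // => l /negPf ->.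
apply/eqP; rewrite -(eqn_add2r 1) -{1}(sum_eq i) -big_split /=; apply/eqP.
rewrite -(sum_eq j) -[X in (X + _)%N](config_sum eta) -big_split /=.
apply: eq_bigr => k _; rewrite ffunE addnAC subnK //.
by have [->|] := eqVneq k i; rewrite ?lt0n.
Qed.

Definition fv_generator (R : realType) (K N : nat) (p : R)
    (f : config K N -> R) (eta : config K N) : R :=
  \sum_(i < K) (eta i)%:R *
    \sum_(j < K) (f (jump i j eta) - f eta) *
      (K%:R^-1 + p * ((eta j)%:R / (N%:R - 1))).

Definition is_distribution (R : realType) (S : finType) (nu : S -> R) : Prop :=
  (forall x, 0 <= nu x) /\ \sum_x nu x = 1.

(* P t x y is the probability of being at y at time t when started from x;    *)
(* only times t >= 0 are constrained.                                         *)
Record is_transition_function (R : realType) (S : finType)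
    (P : R -> S -> S -> R) : Prop := {
  transition_distribution : forall t x, 0 <= t -> is_distribution (P t x);
  transition0 : forall x y, P 0 x y = (x == y)%:R;
  transitionD : forall s t x y, 0 <= s -> 0 <= t ->
    P (s + t) x y = \sum_z P s x z * P t z y
}.

Definition has_generator (R : realType) (S : finType)
    (P : R -> S -> S -> R) (L : (S -> R) -> S -> R) : Prop :=
  forall (f : S -> R) (x : S),
    (\sum_y P h x y * f y - f x) / h @[h --> 0^'+] --> L f x.

Definition is_invariant (R : realType) (S : finType)
    (P : R -> S -> S -> R) (nu : S -> R) : Prop :=
  is_distribution nu /\
  forall t y, 0 <= t -> \sum_x nu x * P t x y = nu y.

Definition mean (R : realType) (S : finType) (nu : S -> R) (f : S -> R) : R :=
  \sum_x nu x * f x.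

Definition cov (R : realType) (S : finType) (nu : S -> R) (f g : S -> R) : R :=
  mean nu (fun x => (f x - mean nu f) * (g x - mean nu g)).

(* Main.v *)
(* Stationarity gives E[L f] = 0 for every f.  For f = eta(k) the selection   *)
(* terms of L f cancel, L eta(k) = N/K - eta(k), so E[eta(k)] = N/K.  For     *)
(* k <> l the only correlated jumps are k -> l and l -> k, whence             *)
(*   L(eta(k) eta(l)) = eta(k) L eta(l) + eta(l) L eta(k)                     *)
(*     - eta(k) (1/K + p eta(l)/(N-1)) - eta(l) (1/K + p eta(k)/(N-1)),       *)
(* a closed equation for the mixed moment, with solution                      *)
(* E[eta(k) eta(l)] = N (N-1)^2 / (K^2 (N-1+p)).                              *)
Require Import Defs.
From mathcomp Require Import all_boot all_order all_algebra.
From mathcomp Require Import all_classical all_reals all_analysis.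
From mathcomp Require Import ring lra.

Import Order.TTheory GRing.Theory Num.Theory.
Import numFieldNormedType.Exports.

Local Open Scope classical_set_scope.
Local Open Scope ring_scope.

(** The covariance is computed exactly for every N >= 2, after which the asymptotics are elementary.
    For k != l the generator preserves the span of 1, eta(k), eta(l) and eta(k) eta(l)
    ([fv_generator_occ], [fv_generator_occM]), so [mean_generator_eq0] yields linear equations for
    the moments, solved in [mean_occ] and [mean_occM]. Subtracting the product of the means, 1/K^2,
    leaves in [cov_occ] a negative covariance of size ((p+1)N - 1) / (K^2 N (N-1+p)), equivalent to
    (p+1)/(K^2 N). *)

Lemma mean_generator_eq0 {R : realType} {S : finType} {P : R -> S -> S -> R}
    {L : (S -> R) -> S -> R} {nu : S -> R} (f : S -> R) :
  has_generator P L -> is_invariant P nu -> mean nu (L f) = 0.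
Proof.
move=> PL [_ nuP].
have lim_nuL : (\sum_x nu x * ((\sum_y P h x y * f y - f x) / h))
    @[h --> 0^'+] --> mean nu (L f).
  apply: cvg_big => [|x _]; first exact: add_continuous.
  by apply: cvgMl_tmp; exact: PL.
(* Under an invariant law f and its image under P h have the same mean, so the averaged difference
   quotient vanishes already for each h > 0. *)
have lim0 : (\sum_x nu x * ((\sum_y P h x y * f y - f x) / h))
    @[h --> 0^'+] --> (0 : R).
  apply: cvg_near_cst; near=> h.
  have h_gt0 : 0 < h by near: h; exact: nbhs_right_gt.
  under eq_bigr => x _ do rewrite mulrA.
  rewrite -mulr_suml; under eq_bigr => x _ do rewrite mulrBr mulr_sumr.
  rewrite sumrB exchange_big /=.
  under eq_bigr => y _.
    under eq_bigr => x _ do rewrite mulrA.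
    rewrite -mulr_suml nuP ?(ltW h_gt0) //; over.
  by rewrite subrr mul0r.
exact: (cvg_unique _ lim_nuL lim0).
Unshelve. all: by end_near. Qed.

Section Mean.
Context {R : realType} {S : finType}.
Implicit Types nu f g : S -> R.

Lemma eq_mean {nu f} g : f =1 g -> mean nu f = mean nu g.
Proof. by move=> fg; apply: eq_bigr => x _; rewrite fg. Qed.

Lemma meanD nu f g : mean nu (fun x => f x + g x) = mean nu f + mean nu g.
Proof. by rewrite -big_split; apply: eq_bigr => x _; rewrite mulrDr. Qed.

Lemma meanZ nu a f : mean nu (fun x => a * f x) = a * mean nu f.
Proof. by rewrite mulr_sumr; apply: eq_bigr => x _; rewrite mulrCA. Qed.

Lemma mean_cst nu a : is_distribution nu -> mean nu (fun=> a) = a.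
Proof. by case=> _ nu1; rewrite /mean -mulr_suml nu1 mul1r. Qed.

Lemma covE nu f g : is_distribution nu ->
  cov nu f g = mean nu (fun x => f x * g x) - mean nu f * mean nu g.
Proof.
move=> nuD; rewrite /cov; set a := mean nu f; set b := mean nu g.
have -> : mean nu (fun x => (f x - a) * (g x - b)) =
    mean nu (fun x => f x * g x + (- b * f x + (- a * g x + a * b))).
  by apply: eq_mean => x; ring.
by rewrite !meanD !meanZ mean_cst // -/a -/b; ring.
Qed.

End Mean.

Section Generator.
Context {R : realType} {K N : nat} (p : R).
Implicit Types (eta : config K N) (i j k l : 'I_K).

Local Notation rate eta j := (K%:R^-1 + p * ((eta j)%:R / (N%:R - 1)) : R).

Lemma natr_jump i j k eta : eta i != 0%N ->
  (jump i j eta k)%:R = (eta k)%:R + ((j == k)%:R - (i == k)%:R) :> R.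
Proof.
move=> eta_i; rewrite jumpE // ffunE natrD natrB; last first.
  by have [->|] := eqVneq k i; rewrite ?lt0n.
by rewrite ![k == _]eq_sym; ring.
Qed.

(** The last sum is the carré du champ: in each jump, f'g' - fg = f(g' - g) + g(f' - f) + (f' -
    f)(g' - g). *)
Lemma fv_generatorM (f g : config K N -> R) eta :
  fv_generator p (fun x => f x * g x) eta =
    f eta * fv_generator p g eta + g eta * fv_generator p f eta +
    \sum_(i < K) (eta i)%:R * \sum_(j < K)
      (f (jump i j eta) - f eta) * (g (jump i j eta) - g eta) * rate eta j.
Proof.
rewrite /fv_generator !mulr_sumr -!big_split /=; apply: eq_bigr => i _.
rewrite !mulr_sumr -!big_split /=; apply: eq_bigr => j _; ring.
Qed.

Lemma sum_delta k (F : 'I_K -> R) : \sum_(i < K) (i == k)%:R * F i = F k.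
Proof.
rewrite (bigD1 k) //= eqxx mul1r big1 ?addr0 // => i /negPf ->.
by rewrite mul0r.
Qed.

Lemma sumr_occ eta : \sum_(i < K) (eta i)%:R = N%:R :> R.
Proof. by rewrite -natr_sum config_sum. Qed.

Lemma sum_rate eta : (0 < K)%N ->
  \sum_(j < K) rate eta j = 1 + p * (N%:R / (N%:R - 1)).
Proof.
move=> K_gt0; rewrite big_split /= sumr_const card_ord -mulr_sumr -mulr_suml.
by rewrite sumr_occ -[_ *+ K]mulr_natl divff // pnatr_eq0 -lt0n.
Qed.

(** Arrivals at k have total rate N (1/K + p eta(k)/(N-1)), departures eta(k) (1 + p N/(N-1)), jumps
    from k to k counting in both; the p terms cancel. *)
Lemma fv_generator_occ k eta :
  fv_generator p (fun x => (x k)%:R) eta = N%:R / K%:R - (eta k)%:R.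
Proof.
have K_gt0 : (0 < K)%N by case: k => m /=; apply: leq_ltn_trans.
have -> : fv_generator p (fun x => (x k)%:R) eta =
    \sum_(i < K) (eta i)%:R *
      \sum_(j < K) ((j == k)%:R * rate eta j - (i == k)%:R * rate eta j).
  (* [natr_jump] needs an occupied site; for an empty one the factor eta(i) kills both sides. *)
  apply: eq_bigr => i _; have [->|eta_i] := eqVneq (eta i) 0%N.
    by rewrite !mul0r.
  by congr (_ * _); apply: eq_bigr => j _; rewrite natr_jump //; ring.
under eq_bigr => i _.
  rewrite sumrB sum_delta -mulr_sumr sum_rate // mulrBr [X in _ - X]mulrCA; over.
rewrite sumrB -mulr_suml sumr_occ sum_delta; ring.
Qed.

Lemma fv_generator_occM k l eta : k != l ->
  fv_generator p (fun x => (x k)%:R * (x l)%:R) eta =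
    (eta k)%:R * (N%:R / K%:R - (eta l)%:R) +
    (eta l)%:R * (N%:R / K%:R - (eta k)%:R) -
    ((eta l)%:R * rate eta k + (eta k)%:R * rate eta l).
Proof.
move=> kl; rewrite fv_generatorM !fv_generator_occ; congr (_ + _).
have delta_kl i : (i == k)%:R * (i == l)%:R = 0 :> R.
  by have [->|] := eqVneq i k; rewrite ?(negPf kl) ?mulr0 ?mul0r.
transitivity (\sum_(i < K) (eta i)%:R * \sum_(j < K)
    ((j == k)%:R * (- (i == l)%:R * rate eta j) +
     (j == l)%:R * (- (i == k)%:R * rate eta j))).
  apply: eq_bigr => i _; have [->|eta_i] := eqVneq (eta i) 0%N.
    by rewrite !mul0r.
  congr (_ * _); apply: eq_bigr => j _; rewrite !natr_jump //.
  (* Expanding the product of the two increments: the terms asking one site to be both k and l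
     vanish, and the cross terms are the jumps between k and l. *)
  transitivity ((j == k)%:R * (- (i == l)%:R * rate eta j) +
      (j == l)%:R * (- (i == k)%:R * rate eta j) +
      ((j == k)%:R * (j == l)%:R + (i == k)%:R * (i == l)%:R) * rate eta j).
    ring.
  by rewrite !delta_kl addr0 mul0r addr0.
under eq_bigr => i _ do rewrite big_split /= !sum_delta.
transitivity (- (\sum_(i < K) (i == l)%:R * ((eta i)%:R * rate eta k) +
                 \sum_(i < K) (i == k)%:R * ((eta i)%:R * rate eta l))).
  by rewrite -big_split -sumrN /=; apply: eq_bigr => i _; ring.
by rewrite !sum_delta.
Qed.

End Generator.

Section Stationary.
Context {R : realType} {K N : nat} {p : R}.
Context {P : R -> config K N -> config K N -> R} {nu : config K N -> R}.
Hypotheses (p_gt0 : 0 < p) (N_ge2 : (2 <= N)%N).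
Hypotheses (PL : has_generator P (@fv_generator R K N p)).
Hypotheses (nuP : is_invariant P nu).

Lemma mean_occ (k : 'I_K) : mean nu (fun eta => (eta k)%:R) = N%:R / K%:R.
Proof.
have := mean_generator_eq0 (fun eta : config K N => (eta k)%:R) PL nuP.
rewrite (eq_mean (fun eta : config K N => N%:R / K%:R + -1 * (eta k)%:R)); last first.
  by move=> eta; rewrite fv_generator_occ mulN1r.
rewrite meanD mean_cst ?meanZ; last by case: nuP.
by move/eqP; rewrite mulN1r subr_eq0 => /eqP.
Qed.

Lemma mean_occM (k l : 'I_K) : k != l ->
  mean nu (fun eta => (eta k)%:R * (eta l)%:R) =
    N%:R * (N%:R - 1) ^+ 2 / (K%:R ^+ 2 * (N%:R - 1 + p)).
Proof.
move=> kl; have K_neq0 : K%:R != 0 :> R.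
  by rewrite pnatr_eq0 -lt0n; case: k {kl} => m /=; apply: leq_ltn_trans.
have N_ge2R : 2 <= N%:R :> R by rewrite ler_nat.
have N1_neq0 : N%:R - 1 != 0 :> R by apply/eqP; lra.
have N1p_neq0 : N%:R - 1 + p != 0 by apply/eqP; have := p_gt0; lra.
have := mean_generator_eq0
  (fun eta : config K N => (eta k)%:R * (eta l)%:R) PL nuP.
(* The correlated jumps lower the linear coefficient from N/K to (N-1)/K, and add -2p/(N-1) to the
   coefficient -2 of the product. *)
rewrite (eq_mean (fun eta : config K N => (N%:R - 1) / K%:R * (eta k)%:R +
  ((N%:R - 1) / K%:R * (eta l)%:R +
   - (2 * (N%:R - 1 + p) / (N%:R - 1)) * ((eta k)%:R * (eta l)%:R)))); last first.
  by move=> eta; rewrite fv_generator_occM //; field; apply/andP.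
rewrite !meanD !meanZ !mean_occ; set E := mean _ _ => mean0.
have EE : 2 * (N%:R - 1 + p) / (N%:R - 1) * E =
    2 * N%:R * (N%:R - 1) / K%:R ^+ 2.
  by rewrite -[LHS]addr0 -mean0; field; apply/andP.
have -> : E = (2 * (N%:R - 1 + p) / (N%:R - 1) * E) *
    ((N%:R - 1) / (2 * (N%:R - 1 + p))) by field; apply/andP.
by rewrite EE; field; apply/andP.
Qed.

Lemma cov_occ (k l : 'I_K) : k != l ->
  cov nu (fun eta => (eta k)%:R / N%:R) (fun eta => (eta l)%:R / N%:R) =
    - (((p + 1) * N%:R - 1) / (K%:R ^+ 2 * N%:R * (N%:R - 1 + p))).
Proof.
move=> kl; have K_neq0 : K%:R != 0 :> R.
  by rewrite pnatr_eq0 -lt0n; case: k {kl} => m /=; apply: leq_ltn_trans.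
have N_ge2R : 2 <= N%:R :> R by rewrite ler_nat.
have N_neq0 : N%:R != 0 :> R by apply/eqP; lra.
have N1p_neq0 : N%:R - 1 + p != 0 by apply/eqP; have := p_gt0; lra.
have mean_frac m : mean nu (fun eta => (eta m)%:R / N%:R) = K%:R^-1.
  rewrite (eq_mean (fun eta : config K N => N%:R^-1 * (eta m)%:R)); last first.
    by move=> eta; rewrite mulrC.
  by rewrite meanZ mean_occ; field; apply/andP.
rewrite covE; last by case: nuP.
rewrite !mean_frac (eq_mean
  (fun eta : config K N => N%:R^-1 ^+ 2 * ((eta k)%:R * (eta l)%:R))); last first.
  by move=> eta; ring.
by rewrite meanZ mean_occM //; field; apply/and3P.
Qed.

End Stationary.

Theorem theorem3p7 (R : realType) (K : nat) (p : R)
  (P : forall N : nat, R -> config K N -> config K N -> R)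
  (nu : forall N : nat, config K N -> R)
  (K_ge1 : (1 <= K)%N) (p_gt0 : 0 < p)
  (P_transition : forall N : nat, (2 <= N)%N -> is_transition_function (P N))
  (P_generator : forall N : nat, (2 <= N)%N ->
    has_generator (P N) (@fv_generator R K N p))
  (nu_invariant : forall N : nat, (2 <= N)%N -> is_invariant (P N) (nu N))
  (i j : 'I_K) (neq_ij : i != j) :
  `|cov (nu N) (fun eta => (eta i)%:R / N%:R) (fun eta => (eta j)%:R / N%:R)| /
    ((p + 1) / (K%:R ^+ 2 * N%:R)) @[N --> \oo] --> (1 : R).
Proof.
have K_neq0 : K%:R != 0 :> R by rewrite pnatr_eq0 -lt0n.
have K2_gt0 : 0 < K%:R ^+ 2 :> R by rewrite exprn_gt0 // ltr0n.
have inv_cvg0 : (N%:R^-1 : R) @[N --> \oo] --> (0 : R).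
  by rewrite -(cvg_shiftS (fun N => N%:R^-1 : R)); exact: cvg_harmonic.
(* This is the target ratio ((p+1)N - 1) / ((p+1)(N-1+p)) with numerator and denominator divided by
   (p+1)N. *)
have lim1 : (1 - (p + 1)^-1 * N%:R^-1) / (1 + (p - 1) * N%:R^-1)
    @[N --> \oo] --> (1 : R).
  rewrite -[X in _ --> X](_ : (1 - (p + 1)^-1 * 0) / (1 + (p - 1) * 0) = 1);
      last first.
    by rewrite !mulr0 subr0 addr0 divr1.
  apply: cvgM; first by apply: cvgB; [exact: cvg_cst|exact: cvgMl_tmp].
  apply: cvgV; first by rewrite mulr0 addr0 oner_neq0.
  by apply: cvgD; [exact: cvg_cst|exact: cvgMl_tmp].
apply: cvg_trans lim1; apply: near_eq_cvg; near=> N.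
have N_ge2 : (2 <= N)%N by near: N; exact: nbhs_infty_ge.
have N_ge2R : 2 <= N%:R :> R by rewrite ler_nat.
have N_gt0 : 0 < N%:R :> R by lra.
have N1p_gt0 : 0 < N%:R - 1 + p by lra.
(* Fixes the sign of the covariance, so that the absolute value just drops the minus. *)
have pN_ge1 : 0 <= (p + 1) * N%:R - 1 by nra.
have D_gt0 : 0 < K%:R ^+ 2 * N%:R * (N%:R - 1 + p).
  by apply: mulr_gt0 => //; exact: mulr_gt0.
rewrite (cov_occ p_gt0 N_ge2 (P_generator N N_ge2) (nu_invariant N N_ge2)) //.
rewrite normrN ger0_norm; last exact: divr_ge0 (ltW D_gt0).
by field; rewrite K_neq0 !lt0r_neq0 //; lra.
Unshelve. all: by end_near. Qed.
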